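(* Under the setting described in the context, let $f\in C(\Omega)$ and let $$f_{\min}(x)=\frac{\int_\Omega f(y)\psi_h(x-y)\,d\mu(y)}{\int_\Omega \psi_h(x-t)\,d\mu(t)},\qquad x\in\Omega.$$ Then there is a constant $C>0$, independent of $h$, such that for all $0<h<1$ and all $1\le p\le\infty$, $$\|f-f_{\min}\|_{L^p(\Omega)}\le C\,\omega_f(h).$$
   Context: Let $d\ge 1$ and let $\Omega\subset\mathbb{R}^d$ be a compact convex domain with Lipschitz boundary. Let $\mu$ be a probability measure on $\Omega$ such that: (1) there is $C_1>0$ with $\mu(\Omega\cap B(x,\alpha))\ge C_1\, m(B(x,\alpha))$ for all $x\in\Omega$ and $0<\alpha\le 1$ ($B(x,\alpha)$ the Euclidean ball, $m$ Lebesgue measure); (2) $\mu$ extends to a finite positive measure $\mu^*$ on $\mathbb{R}^d$ with $\widehat{\mu^*}\in L^1(\mathbb{R}^d)$. Let $\psi\in C(\mathbb{R}^d)$ be nonnegative with $\int_{\mathbb{R}^d}\psi=1$, $\int_{\mathbb{R}^d}|x|\psi(x)\,dx<\infty$, and $\psi(x)\ge C_\psi>0$ for $|x|\le1$; $\psi_h(x)=h^{-d}\psi(x/h)$. $L^p(\Omega)$ norms are with respect to Lebesgue measure. The modulus of continuity is $\omega_f(t)=\sup\{|f(x)-f(y)|: x,y\in\Omega,\ |x-y|\le t\}$. *)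

(* Defs.v *)
(* Euclidean space R^d (d = n+1) is modelled as
   the iterated product  R * (R * ( ... * R))  (n+1 factors) carrying the
   iterated product Lebesgue measure; coordinates are read off by [vec]. *)
From Stdlib Require List.
From HB Require Import structures.
From mathcomp Require Import all_boot all_order all_algebra.
From mathcomp Require Import all_classical all_reals all_analysis.
Set Implicit Arguments. Unset Strict Implicit. Unset Printing Implicit Defensive.
Import Order.TTheory GRing.Theory Num.Theory.
Local Open Scope classical_set_scope.
Local Open Scope ring_scope.

Section prodm.
Local Open Scope ereal_scope.
Context (R : realType) d (T : measurableType d)
  (m2 : {sigma_finite_measure set T -> \bar R}).
Definition prodm := (@lebesgue_measure R \x m2)%E.
HB.instance Definition _ := Measure.on prodm.
Lemma prodm_sf : sigma_finite setT prodm.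
Proof.
have /sigma_finiteP[F [TF ndF Foo]] := sigma_finiteT (@lebesgue_measure R).
have /sigma_finiteP[G [TG ndG Goo]] := sigma_finiteT m2.
exists (fun n => F n `*` G n).
 rewrite -setXTT TF TG predeqE => -[x y]; split.
    move=> [/= [n _ Fnx] [k _ Gky]]; exists (maxn n k) => //; split.
    - by move: x Fnx; exact/subsetPset/ndF/leq_maxl.
    - by move: y Gky; exact/subsetPset/ndG/leq_maxr.
  by move=> [n _ []/= ? ?]; split; exists n.
move=> k; have [? ?] := Foo k; have [? ?] := Goo k.
split; first exact: measurableX.
by rewrite /prodm product_measure1E// lte_mul_pinfty// ge0_fin_numE.
Qed.
HB.instance Definition _ := Measure_isSigmaFinite.Build _ _ _ prodm prodm_sf.
End prodm.

Record mspace (R : realType) := MSpace {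
  msd : measure_display;
  mst :> measurableType msd;
  msm : {sigma_finite_measure set mst -> \bar R} }.

Fixpoint leb_space (R : realType) (n : nat) : mspace R :=
  match n with
  | 0 => @MSpace R _ (measurableTypeR R) (@lebesgue_measure R)
  | n'.+1 => let S := leb_space R n' in
      @MSpace R _ (measurableTypeR R * mst S)%type
        (SigmaFiniteMeasure.clone _ _ _ (prodm (msm S)) _)
  end.

Definition Rspace (R : realType) n : measurableType (msd (leb_space R n)) :=
  mst (leb_space R n).
Definition lebRn (R : realType) n :
  {sigma_finite_measure set Rspace R n -> \bar R} := msm (leb_space R n).

Fixpoint vec (R : realType) (n : nat) : Rspace R n -> 'rV[R]_(n.+1) :=
  match n return Rspace R n -> 'rV[R]_(n.+1) with
  | 0 => fun x => const_mx x
  | n'.+1 => fun x => @row_mx R 1 1 n'.+1 (const_mx x.1) (@vec R n' x.2)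
  end.

Fixpoint unvec (R : realType) (n : nat) : 'rV[R]_(n.+1) -> Rspace R n :=
  match n return 'rV[R]_(n.+1) -> Rspace R n with
  | 0 => fun v => v 0 0
  | n'.+1 => fun v =>
      (v 0 0, @unvec R n' (@rsubmx R 1 1 n'.+1 (v : 'rV[R]_(1 + n'.+1))))
  end.

Section Euclid.
Context (R : realType) (n : nat).
Local Notation T := (Rspace R n).

Definition enorm k (v : 'rV[R]_k) : R := Num.sqrt (\sum_i v 0 i ^+ 2).
Definition dotv k (u v : 'rV[R]_k) : R := \sum_i u 0 i * v 0 i.

Definition vsub (x y : T) : T := unvec (vec x - vec y).
Definition edist (x y : T) : R := enorm (vec x - vec y).

Definition eball (x : T) (a : R) : set T := [set y | edist y x < a].

Definition eopen (A : set T) : Prop :=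
  forall x, A x -> exists2 r : R, 0 < r & eball x r `<=` A.

Definition ecompact (K : set T) : Prop :=
  forall (I : Type) (U : I -> set T), (forall i, eopen (U i)) ->
    K `<=` \bigcup_i U i ->
    exists s : seq I, forall x, K x -> exists2 i, List.In i s & U i x.

Definition econvex (K : set T) : Prop :=
  forall x y, K x -> K y -> forall t : R, 0 <= t <= 1 ->
    K (unvec ((1 - t) *: vec x + t *: vec y)).

Definition has_interior (K : set T) : Prop :=
  exists x, exists2 r : R, 0 < r & eball x r `<=` K.

Definition boundary_pt (K : set T) (x : T) : Prop :=
  (forall r : R, 0 < r -> exists y, eball x r y /\ K y) /\
  (forall r : R, 0 < r -> exists y, eball x r y /\ ~ K y).

(** Lipschitz boundary: near every boundary point, after a rigid motion,
    K is the subgraph of a Lipschitz function of the other n coordinates *)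
Definition lipschitz_boundary (K : set T) : Prop :=
  forall x0, boundary_pt K x0 ->
  exists2 r : R, 0 < r &
  exists Q : 'M[R]_(n.+1), Q *m Q^T = 1%:M /\
  exists g : 'rV[R]_n -> R, exists L : R,
    (forall a b, `|g a - g b| <= L * enorm (a - b)) /\
    (forall y, eball x0 r y ->
       (K y <-> let z : 'rV[R]_(1 + n) := (vec y - vec x0) *m Q in
                (lsubmx z) 0 0 <= g (rsubmx z))).

Definition econtinuous (g : T -> R) : Prop :=
  forall x (eps : R), 0 < eps -> exists2 del : R, 0 < del &
    forall y, edist y x < del -> `|g y - g x| < eps.

Definition econtinuous_on (D : set T) (g : T -> R) : Prop :=
  forall x, D x -> forall (eps : R), 0 < eps -> exists2 del : R, 0 < del &
    forall y, D y -> edist y x < del -> `|g y - g x| < eps.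

Definition psih (psi : T -> R) (h : R) (x : T) : R :=
  h ^- n.+1 * psi (unvec (h^-1 *: vec x)).

Definition fmin (mu : {measure set T -> \bar R}) (Omega : set T) (psi f : T -> R)
    (h : R) (x : T) : R :=
  Rintegral mu Omega (fun y => f y * psih psi h (vsub x y)) /
  Rintegral mu Omega (fun t => psih psi h (vsub x t)).

Definition modcont (Omega : set T) (f : T -> R) (t : R) : R :=
  sup [set r | exists x y, [/\ Omega x, Omega y, edist x y <= t &
                                r = `|f x - f y|]].

(** modulus of the Fourier transform of a finite measure:
    |mu^(xi)| = | \int e^{-i <x,xi>} dmu(x) | *)
Definition fourier_abs (mu : {measure set T -> \bar R}) (xi : T) : R :=
  Num.sqrt ((Rintegral mu setT (fun x => cos (dotv (vec x) (vec xi)))) ^+ 2 +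
            (Rintegral mu setT (fun x => sin (dotv (vec x) (vec xi)))) ^+ 2).

End Euclid.

(* Main.v *)
(* By convexity of Omega, |f x - f y| <= w(h) (1 + |x - y| / h), so |f - f_min| is at most
   w(h) times the quotient of the integrals over Omega of (1 + |x - y| / h) psi_h (x - y)
   and of psi_h (x - y) against mu.  The denominator is bounded below by the ball condition
   and the lower bound of psi on the unit ball.  For the numerator, integrability of the
   Fourier transform gives mu* a bounded density: integrating |\int_Q e^(i a.(y - z)) da|^2
   against mu*, with Q a box of size 1/r, dominates a multiple of mu* (box z r) and is
   bounded by |Q| times the L^1 norm of the transform.  The numerator is thus at most
   K (1 + \int |u| psi u), and only the bounded volume of Omega separates the sup norm
   from the L^p norms. *)
Require Import Defs.
From HB Require Import structures.
From mathcomp Require Import all_boot all_order all_algebra.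
From mathcomp Require Import all_classical all_reals all_analysis.
From mathcomp Require Import measurable_realfun.
From mathcomp Require Import ring lra.
Set Implicit Arguments. Unset Strict Implicit. Unset Printing Implicit Defensive.
Import Order.TTheory GRing.Theory Num.Theory.
Import numFieldNormedType.Exports.
Local Open Scope classical_set_scope.
Local Open Scope ring_scope.

(** Uniformity in h rests on matching powers of h. The factor h^-d of psi_h is compensated in the
    denominator by the h^d of the ball condition; in the numerator the same happens once mu* charges
    small boxes at most like Lebesgue measure. Since psi may have mass far from the origin, w(h)
    alone does not bound |f x - f y| under the integral, hence the weight 1 + |x - y| / h and the
    first moment of psi. No density function is constructed: bounded density means
    [nu (box z r) <= K m (box z r)] for all boxes, which is passed on to integrals of nonnegative
    continuous functions. The square of the modulus is chosen because it is nonnegative at every y,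
    so keeping only y in the box loses nothing, while there the phases are at most 1 and cos >= cos
    1 > 0 excludes cancellation. Expanded as a double integral over a and b and integrated in y
    first, the same square only involves the transform at a - b, whose integral in b is at most its
    L^1 norm for each fixed a. *)

(** * Coordinates on the iterated product and their measurability *)

Lemma unvecK (R : realType) n : cancel (@unvec R n) (@vec R n).
Proof.
elim: n => [|n IH] v /=; first by apply/rowP => i; rewrite mxE ord1.
rewrite IH; apply: etrans (@hsubmxK R 1 1 n.+1 v).
congr (@row_mx R 1 1 n.+1 _ _).
apply/rowP => i; rewrite !mxE; congr (v _ _); apply: val_inj; by rewrite /= ord1.
Qed.

Lemma measurable_coord (R : realType) n (i : 'I_n.+1) :
  measurable_fun setT (fun x : Rspace R n => vec x 0 i).
Proof.
elim: n i => [|n IH] i.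
  apply: (eq_measurable_fun (fun x : Rspace R 0 => x)); last exact: measurable_id.
  by move=> x _ /=; rewrite mxE.
(* The index is retyped in the convertible type ['I_(1 + n.+1)], so that [split] separates the head
   coordinate from the tail. *)
have [j ->] : exists j : 'I_(1 + n.+1), i = j by exists i.
rewrite -(splitK j); case: (fintype.split j) => k.
  apply: (eq_measurable_fun (fun x : Rspace R n.+1 => x.1)); last exact: measurable_fst.
  by move=> x _ /=; rewrite (@row_mxEl R 1 1 n.+1) mxE.
apply: (eq_measurable_fun (fun x : Rspace R n.+1 => vec x.2 0 k)).
  by move=> x _ /=; rewrite (@row_mxEr R 1 1 n.+1).
exact: (measurableT_comp (IH k) measurable_snd).
Qed.

Lemma measurable_unvec (R : realType) n d (S : measurableType d)
    (g : S -> 'rV[R]_n.+1) :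
  (forall i, measurable_fun setT (fun s => g s 0 i)) ->
  measurable_fun setT (fun s => unvec (g s) : Rspace R n).
Proof.
elim: n g => [|n IH] g mg; first exact: mg.
apply/measurable_fun_pairP; split; first exact: mg.
apply: IH => i; apply: (eq_measurable_fun (fun s => g s 0 (rshift 1 i))) => //.
by move=> s _; rewrite mxE.
Qed.

(** * Change of variables under a homothety followed by a translation *)

Section affine.
Context (R : realType).
Local Open Scope ereal_scope.

(** Uniqueness of Lebesgue measure: [|a|] times the pushforward under x -> a x + b gives half-open
    intervals their length. *)
Lemma lebesgue_measure_affine (a b : R) (A : set R) : a != 0%R -> measurable A ->
  lebesgue_measure ((fun x => a * x + b)%R @^-1` A) = (`|a|^-1)%:E * lebesgue_measure A.
Proof.
move=> a0 mA; set phi := (fun x => a * x + b)%R.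
have mphi : measurable_fun setT (phi : measurableTypeR R -> measurableTypeR R).
  by apply: measurable_funD => //; exact: measurable_funM.
pose c : {nonneg R} := NngNum (normr_ge0 a).
pose m0 : {measure set (measurableTypeR R) -> \bar R} :=
  mscale c (pushforward lebesgue_measure (phi : measurableTypeR R -> measurableTypeR R)).
pose m' := m0 mphi.
have H : forall X, ocitv X -> lebesgue_measure X = m' X.
  move=> _ [[u v]] _ <- /=.
  rewrite /m' /m0 /= /mscale /= /pushforward.
  case: (ltP 0%R a) => [ap|an].
    have -> : phi @^-1` `]u, v]%classic = `](u - b) / a, (v - b) / a]%classic%R.
      apply/seteqP; split => x /=; rewrite !in_itv /= /phi.
        by rewrite ltr_pdivrMr// ler_pdivlMr// ltrBlDr lerBrDr [(x * a)%R]mulrC.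
      by rewrite ltr_pdivrMr// ler_pdivlMr// ltrBlDr lerBrDr [(x * a)%R]mulrC.
    rewrite !lebesgue_measure_itv /= !lte_fin ltr_pM2r ?invr_gt0// ltrD2r.
    case: ifP => uv; last by rewrite mule0.
    by rewrite -!EFinB -EFinM gtr0_norm//; congr EFin; field.
  (* A negative factor moves the closed end of the interval to the left; the length is
     unaffected. *)
  have {}an : (a < 0)%R by rewrite lt_neqAle a0.
  have -> : phi @^-1` `]u, v]%classic = `[(v - b) / a, (u - b) / a[%classic%R.
    apply/seteqP; split => x /=; rewrite !in_itv /= /phi.
      by rewrite ltr_ndivlMr// ler_ndivrMr// lerBrDr ltrBlDr [(x * a)%R]mulrC andbC.
    by rewrite ltr_ndivlMr// ler_ndivrMr// lerBrDr ltrBlDr [(x * a)%R]mulrC andbC.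
  rewrite !lebesgue_measure_itv /= !lte_fin ltr_nM2r ?invr_lt0// ltrD2r.
  case: ifP => uv; last by rewrite mule0.
  by rewrite -!EFinB -EFinM ltr0_norm//; congr EFin; field.
rewrite (@lebesgue_measure_unique R m' H A mA) /m' /m0 /= /mscale /= /pushforward.
by rewrite muleA -EFinM mulVf ?mul1e// normr_eq0.
Qed.

Lemma ge0_lebesgue_integral_affine (a b : R) (g : measurableTypeR R -> \bar R) :
  a != 0%R -> measurable_fun setT g -> (forall x, 0 <= g x) ->
  \int[lebesgue_measure]_x g (a * x + b)%R =
  (`|a|^-1)%:E * \int[lebesgue_measure]_x g x.
Proof.
move=> a0 mg g0; set phi := (fun x => a * x + b)%R.
have mphi : measurable_fun setT (phi : measurableTypeR R -> measurableTypeR R).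
  by apply: measurable_funD => //; exact: measurable_funM.
have c0 : (0 <= `|a|^-1 :> R)%R by rewrite invr_ge0.
have := @ge0_integral_pushforward _ _ (measurableTypeR R) (measurableTypeR R) R
  phi mphi (@lebesgue_measure R) setT g measurableT mg (fun x _ => g0 x).
rewrite preimage_setT => <-.
rewrite -(@ge0_integral_mscale _ (measurableTypeR R) R (@lebesgue_measure R) setT
  measurableT (NngNum c0) g)//.
apply: eq_measure_integral => A mA _ /=.
by rewrite /pushforward /= lebesgue_measure_affine.
Qed.

Lemma measurable_affine n (a : R) (b : 'rV[R]_n.+1) :
  measurable_fun setT (fun y : Rspace R n => unvec (a *: vec y + b) : Rspace R n).
Proof.
apply: (@measurable_unvec R n _ _ (fun y => a *: vec y + b)%R) => i.
apply: (eq_measurable_fun (fun y => a * vec y 0 i + b 0 i)%R).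
  by move=> y _; rewrite !mxE.
by apply: measurable_funD => //; apply: measurable_funM => //; exact: measurable_coord.
Qed.

(** The map acts on each coordinate separately, so Tonelli peels off one factor [|a|^-1] per
    coordinate and no general Jacobian formula is needed. *)
Lemma ge0_lebRn_integral_affine n (a : R) (b : 'rV[R]_n.+1) (g : Rspace R n -> \bar R) :
  a != 0%R -> measurable_fun setT g -> (forall x, 0 <= g x) ->
  \int[lebRn R n]_y g (unvec (a *: vec y + b)) =
  (`|a| ^- n.+1)%:E * \int[lebRn R n]_y g y.
Proof.
move=> a0; elim: n b g => [|n IH] b g mg g0.
  rewrite expr1 -(ge0_lebesgue_integral_affine (b 0 0)%R a0 mg g0).
  by apply: eq_integral => y _; rewrite /= !mxE.
have mag := measurableT_comp mg (measurable_affine a b).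
have E (h : Rspace R n.+1 -> \bar R) (mh : measurable_fun setT h) (h0 : forall x, 0 <= h x) :
   \int[lebRn R n.+1]_y h y = \int[lebesgue_measure]_x \int[lebRn R n]_y h (x, y).
  exact: (@fubini_tonelli1 _ _ _ _ _ (@lebesgue_measure R) (lebRn R n) h mh h0).
rewrite (E _ mag) ?(E _ mg)//; last by move=> x; exact: g0.
pose b' : 'rV[R]_n.+1 := @rsubmx R 1 1 n.+1 b.
pose G (x : measurableTypeR R) := \int[lebRn R n]_y g (x, y).
have mG : measurable_fun setT G.
  exact: (@measurable_fun_fubini_tonelli_F _ _ _ _ _ (lebRn R n) g mg g0).
have G0 x : 0 <= G x by apply: integral_ge0 => y _; exact: g0.
transitivity (\int[lebesgue_measure]_x ((`|a| ^- n.+1)%:E * G (a * x + b 0 0)%R)).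
  apply: eq_integral => x _; rewrite /G -(IH b').
  - apply: eq_integral => y _ /=; congr (g (_, unvec _)).
      rewrite !mxE; congr (_ * _ + _)%R.
      by rewrite /split; case: splitP => // j _; rewrite mxE.
    by rewrite linearD linearZ /= (@row_mxKr R 1 1 n.+1).
  - exact: (measurableT_comp mg (measurable_pair1 _)).
  - by move=> y; exact: g0.
rewrite ge0_integralZl//; last first.
  have mphi : measurable_fun setT
      (fun x : measurableTypeR R => a * x + b 0 0 : measurableTypeR R)%R.
    by apply: measurable_funD => //; exact: measurable_funM.
  exact: (measurableT_comp mG mphi).
rewrite (ge0_lebesgue_integral_affine _ a0 mG G0) muleA -EFinM; congr (_ * _).
by congr EFin; rewrite [(`|a| ^+ n.+2)%R]exprS invfM mulrC.
Qed.

End affine.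

(** * The Euclidean norm: Cauchy-Schwarz and the triangle inequality *)

Section euclidean_norm.
Context (R : realType).
Implicit Types (k n : nat).

Lemma enorm_ge0 k (v : 'rV[R]_k) : 0 <= enorm v.
Proof. exact: sqrtr_ge0. Qed.

Lemma enormZ k (a : R) (v : 'rV[R]_k) : enorm (a *: v) = `|a| * enorm v.
Proof.
rewrite /enorm -sqrtr_sqr -sqrtrM ?sqr_ge0//; congr Num.sqrt.
by rewrite mulr_sumr; apply: eq_bigr => i _; rewrite mxE exprMn.
Qed.

Lemma enormN k (v : 'rV[R]_k) : enorm (- v) = enorm v.
Proof. by rewrite -scaleN1r enormZ normrN1 mul1r. Qed.

Lemma enorm0 k : enorm (0 : 'rV[R]_k) = 0.
Proof. by rewrite -(scale0r 0) enormZ normr0 mul0r. Qed.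

Lemma coord_le_enorm k (v : 'rV[R]_k) i : `|v 0 i| <= enorm v.
Proof.
rewrite -sqrtr_sqr ler_sqrt ?sumr_ge0// => [|j _]; last exact: sqr_ge0.
by rewrite (bigD1 i)//= lerDl sumr_ge0// => j _; exact: sqr_ge0.
Qed.

Lemma enorm_le_coord n (v : 'rV[R]_n.+1) r :
  (forall i, `|v 0 i| <= r) -> enorm v <= n.+1%:R * r.
Proof.
move=> vr; have r0 : 0 <= r := le_trans (normr_ge0 _) (vr 0).
rewrite -(ger0_norm (mulr_ge0 (ler0n _ _) r0)) -sqrtr_sqr ler_sqrt ?sqr_ge0//.
apply: (@le_trans _ _ (\sum_(i < n.+1) r ^+ 2)).
  by apply: ler_sum => i _; rewrite -(real_normK (num_real (v 0 i))) lerXn2r// nnegrE.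
rewrite sumr_const card_ord -[leLHS]mulr_natl exprMn; apply: ler_wpM2r; first exact: sqr_ge0.
by rewrite -natrX ler_nat -{1}(expn1 n.+1) leq_pexp2l.
Qed.

(** With A, B the squared norms and D the product, B (A B - D^2) is the squared norm of B u - D v.
    Dividing by B requires the case [v = 0] to be treated apart. *)
Lemma cauchy_schwarz k (u v : 'rV[R]_k) : dotv u v <= enorm u * enorm v.
Proof.
rewrite /enorm -sqrtrM; last by apply: sumr_ge0 => i _; exact: sqr_ge0.
set A := \sum_i u 0 i ^+ 2; set B := \sum_i v 0 i ^+ 2; set D := dotv u v.
have B0 : 0 <= B by apply: sumr_ge0 => i _; exact: sqr_ge0.
suff DAB : D ^+ 2 <= A * B.
  by apply: le_trans (ler_norm _) _; rewrite -sqrtr_sqr ler_sqrt// (le_trans (sqr_ge0 D)).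
have [B_gt0|] := ltP 0 B; last first.
  move=> Ble0; have B_eq0 : B = 0 by apply/eqP; rewrite eq_le Ble0.
  have v0 i : v 0 i = 0.
    apply/eqP; rewrite -sqrf_eq0; apply/eqP.
    by have := psumr_eq0P (fun j _ => sqr_ge0 (v 0 j)) B_eq0; apply.
  by rewrite /D /dotv big1 ?expr0n/= ?B_eq0 ?mulr0// => i _; rewrite v0 mulr0.
rewrite -subr_ge0 -(pmulr_rge0 _ B_gt0).
have -> : B * (A * B - D ^+ 2) = \sum_i (B * u 0 i - D * v 0 i) ^+ 2.
  under eq_bigr do rewrite sqrrB !exprMn.
  rewrite big_split /= sumrB -!mulr_sumr -/A -/B.
  have -> : \sum_i (B * u 0 i * (D * v 0 i)) *+ 2 = (B * D * D) *+ 2.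
    rewrite sumrMnl; congr (_ *+ 2); rewrite {3}/D /dotv mulr_sumr.
    by apply: eq_bigr => i _; ring.
  ring.
by apply: sumr_ge0 => i _; exact: sqr_ge0.
Qed.

Lemma ler_enormD k (u v : 'rV[R]_k) : enorm (u + v) <= enorm u + enorm v.
Proof.
rewrite -(ger0_norm (addr_ge0 (enorm_ge0 u) (enorm_ge0 v))) -sqrtr_sqr.
rewrite ler_sqrt ?sqr_ge0// sqrrD !sqr_sqrtr; do ?by apply: sumr_ge0 => i _; exact: sqr_ge0.
under eq_bigr do rewrite mxE sqrrD.
rewrite big_split/= big_split/= lerD2r lerD2l sumrMnl; apply: ler_wMn2r.
exact: cauchy_schwarz.
Qed.

Lemma ler_dist_enorm k (u v : 'rV[R]_k) : `|enorm u - enorm v| <= enorm (u - v).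
Proof.
have H (a b : 'rV[R]_k) : enorm a - enorm b <= enorm (a - b).
  by rewrite lerBlDr (le_trans _ (ler_enormD _ _))// subrK.
by rewrite ler_norml lerNl opprB H -(enormN (u - v)) opprB H.
Qed.

End euclidean_norm.

(** * Boxes, measurability of open sets and of continuous functions *)

Section boxes.
Context (R : realType).
Implicit Types n : nat.

(** Balls of the sup norm: being products of intervals, they have an explicit Lebesgue measure by
    induction, which Euclidean balls do not. *)
Definition box n (x : Rspace R n) (r : R) : set (Rspace R n) :=
  [set y | forall i, `|vec y 0 i - vec x 0 i| < r].

Lemma boxS n (x : Rspace R n.+1) r :
  box x r = ball (x.1 : R) r `*` @box n x.2 r.
Proof.
apply/seteqP; split => -[a b] /= H.
  split=> [|i] /=.
    rewrite -ball_normE /= distrC.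
    by have := H (@lshift 1 n.+1 0); rewrite !(@row_mxEl R 1 1 n.+1) !mxE.
  by have := H (@rshift 1 n.+1 i); rewrite !(@row_mxEr R 1 1 n.+1).
move=> i; have [j ->] : exists j : 'I_(1 + n.+1), i = j by exists i.
rewrite -(splitK j); case: (fintype.split j) => k /=.
  rewrite !(@row_mxEl R 1 1 n.+1) !mxE distrC.
  by have := H.1; rewrite -ball_normE.
by rewrite !(@row_mxEr R 1 1 n.+1); exact: H.2.
Qed.

Lemma box0 (x : Rspace R 0) r : box x r = ball (x : R) r.
Proof.
apply/seteqP; split => y /=.
  by move=> /(_ 0); rewrite !mxE -ball_normE /= distrC.
by rewrite -ball_normE /= => H i; rewrite !mxE distrC.
Qed.

Lemma measurable_box n (x : Rspace R n) r : measurable (box x r).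
Proof.
elim: n x => [|n IH] x; first by rewrite box0; exact: measurable_ball.
by rewrite boxS; apply: measurableX => //; exact: measurable_ball.
Qed.

Lemma lebRn_box n (x : Rspace R n) r : 0 <= r ->
  lebRn R n (box x r) = ((r *+ 2) ^+ n.+1)%:E.
Proof.
move=> r0; elim: n x => [|n IH] x.
  by rewrite box0 expr1 [LHS](lebesgue_measure_ball _ r0).
rewrite boxS exprS.
have := product_measure1E (@lebesgue_measure R) (lebRn R n)
  (measurable_ball (x.1 : R) r) (measurable_box x.2 r).
rewrite IH [X in _ = X -> _](_ : _ = (r *+ 2)%:E * ((r *+ 2) ^+ n.+1)%:E)%E.
  by rewrite -EFinM.
by congr (_ * _)%E; exact: lebesgue_measure_ball.
Qed.

(* [edist] unqualified is the extended distance of MathComp-Analysis. *)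
Lemma eball_sub_box n (x : Rspace R n) r : eball x r `<=` box x r.
Proof.
move=> y; rewrite /eball/= /Defs.edist => xy i.
by apply: le_lt_trans xy; apply: le_trans (coord_le_enorm _ i); rewrite !mxE.
Qed.

(** Dividing by [n.+2] rather than by the dimension [n.+1] makes the final inequality strict. *)
Lemma box_sub_eball n (x : Rspace R n) r : 0 < r ->
  box x (r / n.+2%:R) `<=` eball x r.
Proof.
move=> r0 y xy; rewrite /eball/= /Defs.edist.
have := @enorm_le_coord R n (vec y - vec x) (r / n.+2%:R).
move=> /(_ _)/le_lt_trans; apply.
  by move=> i; rewrite !mxE ltW.
by rewrite mulrCA gtr_pMr// ltr_pdivrMr// mul1r ltr_nat.
Qed.

(* The countable family of boxes with rational centres and radii 1/(k+1) is a base. *)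
Lemma measurable_eopen n (U : set (Rspace R n)) : eopen U -> measurable U.
Proof.
move=> oU.
pose c (q : 'rV[rat]_n.+1) : Rspace R n := unvec (map_mx ratr q).
pose F (qk : 'rV[rat]_n.+1 * nat) :=
  if `[< box (c qk.1) qk.2.+1%:R^-1 `<=` U >] then box (c qk.1) qk.2.+1%:R^-1 else set0.
rewrite (_ : U = \bigcup_qk F qk).
  apply: countable_bigcupT_measurable => // qk; rewrite /F.
  by case: ifP => // _; exact: measurable_box.
apply/seteqP; split => [x Ux|x [qk _]]; last first.
  by rewrite /F; case: asboolP => // sub xb; exact: sub.
have [r r0 xr] := oU _ Ux.
pose r' := r / n.+2%:R.
have r'0 : 0 < r' by rewrite divr_gt0.
(* Half of [r'] is spent between x and the rational centre, the other half between that centre and a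
   point of its box. *)
have [k] := ltr_add_invr (divr_gt0 r'0 (ltr0n _ 2)).
rewrite add0r => kr.
have /choice[q qP] (i : 'I_n.+1) :
    exists q : rat, ratr q \in `](vec x 0 i - k.+1%:R^-1), vec x 0 i[.
  by apply: rat_in_itvoo; rewrite gtrBl invr_gt0.
exists (\row_i q i, k) => //; rewrite /F /=.
have cE i : vec (c (\row_i q i)) 0 i = ratr (q i) by rewrite /c unvecK !mxE.
have qx i : `|vec x 0 i - vec (c (\row_i q i)) 0 i| < k.+1%:R^-1.
  have := qP i; rewrite in_itv/= cE => /andP[q1 q2].
  by rewrite gtr0_norm ?subr_gt0// ltrBlDr addrC -ltrBlDr.
case: asboolP => // -[] y yq; apply: xr; apply: box_sub_eball => // i.
rewrite -(subrKA (vec (c (\row_i q i)) 0 i)).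
apply: le_lt_trans (ler_normD _ _) _.
rewrite -/r' (splitr r'); apply: ltrD.
  exact: lt_trans (yq i) kr.
by rewrite distrC; exact: lt_trans (qx i) kr.
Qed.

Lemma eopen_eball n (x : Rspace R n) r : eopen (eball x r).
Proof.
move=> y; rewrite /eball /= /Defs.edist => yx.
exists (r - enorm (vec y - vec x)); first by rewrite subr_gt0.
move=> z; rewrite /eball /= => zy; rewrite /Defs.edist.
 have -> : vec z - vec x = (vec z - vec y) + (vec y - vec x) by rewrite addrA subrK.
rewrite (le_lt_trans (ler_enormD _ _))//.
by rewrite -ltrBrDr.
Qed.

Lemma measurable_eball n (x : Rspace R n) r : measurable (eball x r).
Proof. by apply: measurable_eopen; exact: eopen_eball. Qed.

(** A superlevel set of g is only relatively open in D. The union of all balls whose trace on D lies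
    in it is an open set with the same trace. *)
Lemma measurable_econtinuous_on n (D : set (Rspace R n)) (g : Rspace R n -> R) :
  econtinuous_on D g -> measurable_fun D g.
Proof.
move=> cg mD; apply: (measurability _ (RGenOInfty.measurableE R)) => //.
move=> /= _ [_ [a ->] <-]; rewrite preimage_itvoy.
pose U := \bigcup_(xr in [set xr : Rspace R n * R |
   eball xr.1 xr.2 `&` D `<=` [set x | a < g x]]) eball xr.1 xr.2.
rewrite (_ : _ `&` _ = D `&` U).
  apply: measurableI => //; apply: measurable_eopen => x [xr xrP xxr].
  have [r r0 sub] := eopen_eball xxr; exists r => // y /sub yxr.
  by exists xr.
apply/seteqP; split => x /= [Dx].
  move=> agx; split=> //.
  have ga : 0 < g x - a by rewrite subr_gt0.
  have [del del0 cgx] := cg x Dx _ ga.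
  exists (x, del) => /=; last by rewrite /eball /= /Defs.edist subrr enorm0.
  move=> y [/= yx Dy]; have := cgx y Dy yx.
  by rewrite ltr_norml opprB => /andP[+ _]; rewrite ltrD2r.
by move=> [xr xrP xxr]; split=> //; apply: xrP.
Qed.

Lemma measurable_econtinuous n (g : Rspace R n -> R) :
  econtinuous g -> measurable_fun setT g.
Proof.
move=> cg; apply: measurable_econtinuous_on => x _ eps eps0.
by have [del del0 H] := cg x eps eps0; exists del => // y _; exact: H.
Qed.

End boxes.

(** * From a bound on boxes to a bound on integrals *)

Section box_averages.
Context (R : realType).
Local Open Scope ereal_scope.

Lemma limn_einf_le (u : (\bar R)^nat) M : (forall k, u k <= M) -> limn_einf u <= M.
Proof.
move=> uM; rewrite limn_einf_lim (cvg_lim _ (@cvg_einfs_sup _ u))//.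
apply: ge_ereal_sup => _ [k _ <-].
by apply: le_trans (uM k); apply: ereal_inf_lbound; exists k => /=.
Qed.

Lemma limn_einf_ge (u : (\bar R)^nat) a N :
  (forall k, (N <= k)%N -> a <= u k) -> a <= limn_einf u.
Proof.
move=> uM; rewrite limn_einf_lim (cvg_lim _ (@cvg_einfs_sup _ u))//.
apply: (@le_trans _ _ (einfs u N)); last by apply: ereal_sup_ubound; exists N.
by apply: le_ereal_inf_tmp => _ [k /= Nk <-]; exact: uM.
Qed.

Lemma measurable_box2 n (r : R) :
  measurable [set xy : Rspace R n * Rspace R n | box xy.1 r xy.2].
Proof.
pose S (i : 'I_n.+1) := [set xy : Rspace R n * Rspace R n |
   (`|vec xy.2 0 i - vec xy.1 0 i| < r)%R].
rewrite (_ : [set _ | _] = \bigcap_(i in [set: 'I_n.+1]) S i); last first.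
  by apply/seteqP; split => xy /= H i; [move=> _; exact: H|exact: (H i Logic.I)].
apply: fin_bigcap_measurable => // i _.
have mf : measurable_fun setT (fun xy : Rspace R n * Rspace R n =>
    `|vec xy.2 0 i - vec xy.1 0 i|)%R.
  apply: measurableT_comp => //; apply: measurable_funB.
    exact: (measurableT_comp (measurable_coord i) measurable_snd).
  exact: (measurableT_comp (measurable_coord i) measurable_fst).
have := mf measurableT `]-oo, r[%classic (measurable_itv _).
by rewrite setTI preimage_itvNyo.
Qed.

Lemma box_sym n (x y : Rspace R n) r : box x r y -> box y r x.
Proof. by move=> H i; rewrite distrC. Qed.

(* Average g over small boxes, exchange the integrals, and let the boxes shrink. *)
Lemma ge0_le_integral_box_density n
    (nu : {sigma_finite_measure set Rspace R n -> \bar R}) (K : R)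
    (g : Rspace R n -> R) :
  (0 <= K)%R ->
  (forall z r, (0 < r)%R -> nu (box z r) <= K%:E * lebRn R n (box z r)) ->
  econtinuous g -> (forall x, 0 <= g x)%R ->
  \int[nu]_x (g x)%:E <= K%:E * \int[lebRn R n]_x (g x)%:E.
Proof.
move=> K0 nuK cg g0.
have mg := measurable_econtinuous cg.
pose r k : R := k.+1%:R^-1%R.
have r_gt0 k : (0 < r k)%R by rewrite invr_gt0.
pose v k : R := ((r k *+ 2) ^+ n.+1)%R.
have v_gt0 k : (0 < v k)%R by rewrite exprn_gt0// mulrn_wgt0.
pose S k := [set xy : Rspace R n * Rspace R n | box xy.1 (r k) xy.2].
pose F k (xy : Rspace R n * Rspace R n) : \bar R :=
  (((v k)^-1 * g xy.2) * \1_(S k) xy)%:E.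
have mF k : measurable_fun setT (F k).
  apply/measurable_EFinP; apply: measurable_funM.
    apply: measurable_funM => //; exact: (measurableT_comp mg measurable_snd).
  by apply: measurable_indic; exact: measurable_box2.
have F0 k xy : 0 <= F k xy.
  by rewrite lee_fin mulr_ge0// mulr_ge0// invr_ge0 ltW.
(* The average of g over [box x (r k)], since [v k] is the volume of that box. *)
pose A k x := \int[lebRn R n]_y F k (x, y).
have mA k : measurable_fun setT (A k).
  exact: (@measurable_fun_fubini_tonelli_F _ _ _ _ _ (lebRn R n) (F k) (mF k) (F0 k)).
have A0 k x : 0 <= A k x by apply: integral_ge0.
(* The relation [box x r y] is symmetric, so integrating in x first leaves [g y / v k] times the
   nu-mass of [box y (r k)], which is at most [K * v k]. *)
have intA k : \int[nu]_x A k x <= K%:E * \int[lebRn R n]_x (g x)%:E.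
  rewrite /A (@fubini_tonelli _ _ _ _ _ nu (lebRn R n) (F k) (mF k) (F0 k)).
  rewrite -ge0_integralZl//; last 2 first.
    exact/measurable_EFinP.
    by move=> x _; rewrite lee_fin.
  apply: ge0_le_integral => //.
  - by move=> x _; exact: integral_ge0.
  - exact: (@measurable_fun_fubini_tonelli_G _ _ _ _ _ nu (F k) (mF k) (F0 k)).
  - by apply/measurable_EFinP; apply: measurable_funM.
  move=> y _.
  have -> : \int[nu]_x F k (x, y) = ((v k)^-1 * g y)%:E * nu (box y (r k)).
    rewrite -[in RHS](setIT (box _ _)) -integral_indic//; last exact: measurable_box.
    rewrite -ge0_integralZl//.
    - apply: eq_integral => x _; rewrite /F -EFinM; congr (_ * _)%:E.
      by rewrite !indicE; congr (nat_of_bool _)%:R; apply/idP/idP; rewrite !inE => /box_sym.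
    - by apply/measurable_EFinP; apply: measurable_indic; exact: measurable_box.
    - by rewrite lee_fin mulr_ge0// invr_ge0 ltW.
  have c0 : 0 <= ((v k)^-1 * g y)%:E by rewrite lee_fin mulr_ge0// invr_ge0 ltW.
  apply: le_trans (lee_wpmul2l c0 (nuK y _ (r_gt0 k))) _.
  rewrite lebRn_box; last exact: ltW.
  rewrite -!EFinM lee_fin -/(v k).
  by rewrite le_eqVlt; apply/orP; left; apply/eqP; field; rewrite gt_eqF.
apply: le_trans (limn_einf_le intA).
(* By Fatou it remains to see that the averages have a lower limit at least g, and pointwise
   continuity is enough for that. *)
apply: le_trans (fatou nu measurableT mA (fun k x _ => A0 k x)).
apply: ge0_le_integral => //.
- by move=> x _; rewrite lee_fin.
- exact/measurable_EFinP.
- apply: (eq_measurable_fun (fun x => - limn_esup (fun k => - A k x))).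
    by move=> x _; rewrite -[RHS]oppeK -limn_esupN.
  apply: measurableT_comp => //; apply: measurable_fun_limn_esup => k.
  exact: measurableT_comp.
move=> x _; apply/lee_addgt0Pr => e e0.
have [del del0 gx] := cg x e e0.
have [N] := ltr_add_invr (divr_gt0 del0 (ltr0n _ n.+2)).
rewrite add0r => Ndel.
rewrite -leeBlDr//; apply: (@limn_einf_ge _ _ N) => k Nk.
rewrite -EFinB.
(* Once [g x - e] is positive, it is the average of a nonnegative constant and can be compared with
   [A k x] under the integral. *)
have [ge0|gepos] := leP (g x - e)%R 0%R; first by apply: le_trans (A0 k x); rewrite lee_fin.
have -> : (g x - e)%:E = \int[lebRn R n]_y (((v k)^-1 * (g x - e)) * \1_(box x (r k)) y)%:E.
  under eq_integral do rewrite EFinM.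
  rewrite ge0_integralZl//.
  - rewrite integral_indic ?setIT//; last exact: measurable_box.
    transitivity (((v k)^-1 * (g x - e))%:E * (v k)%:E); last first.
      by congr (_ * _); apply/esym/lebRn_box/ltW.
    by rewrite -EFinM; congr EFin; field; rewrite gt_eqF.
  - by apply/measurable_EFinP; apply: measurable_indic; exact: measurable_box.
  - by rewrite lee_fin mulr_ge0 ?invr_ge0 ?ltW.
apply: ge0_le_integral => //.
- by move=> y _; rewrite lee_fin mulr_ge0// mulr_ge0 ?invr_ge0 ?ltW.
- apply/measurable_EFinP; apply: measurable_funM => //.
  by apply: measurable_indic; exact: measurable_box.
- exact: (measurableT_comp (mF k) (measurable_pair1 _)).
move=> y _; rewrite /F lee_fin !indicE.
rewrite (_ : ((x, y) \in S k) = (y \in box x (r k))); last first.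
  by apply/idP/idP; rewrite !inE.
case: (boolP (y \in _)); rewrite ?mulr0// !mulr1 inE => yx.
rewrite ler_pM2l ?invr_gt0// lerBlDr -lerBlDl.
suff /gx : (Defs.edist y x < del)%R by rewrite distrC => /(le_lt_trans (ler_norm _))/ltW.
apply: box_sub_eball => // i; apply: lt_le_trans (yx i) _.
apply/ltW/(le_lt_trans _ Ndel).
by rewrite /r lef_pV2 ?posrE// ler_nat.
Qed.

End box_averages.

(** * Cosine and sine integrals against finite measures *)

Section trigonometric_integrals.
Context d (T : measurableType d) (R : realType).
Variable P : {finite_measure set T -> \bar R}.

Lemma measurable_cos : measurable_fun setT (@cos R).
Proof. by apply: continuous_measurable_fun; exact: continuous_cos. Qed.

Lemma measurable_sin : measurable_fun setT (@sin R).
Proof. by apply: continuous_measurable_fun; exact: continuous_sin. Qed.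

Lemma le_bounded_integrable (h : T -> R) M :
  measurable_fun setT h -> (forall x, `|h x| <= M) ->
  P.-integrable setT (EFin \o h).
Proof.
move=> mh hM; apply: measurable_bounded_integrable => //.
  by rewrite ltey_eq fin_num_measure.
by exists M; split; [exact: num_real|move=> r Mr x _ /=; exact: le_trans (hM x) (ltW Mr)].
Qed.

Variables (theta : T -> R) (mtheta : measurable_fun setT theta).

Lemma integrable_cos : P.-integrable setT (EFin \o (cos \o theta)).
Proof.
apply: (@le_bounded_integrable _ 1) => [|x]; last exact: cos_max.
exact: measurableT_comp measurable_cos _.
Qed.

Lemma integrable_sin : P.-integrable setT (EFin \o (sin \o theta)).
Proof.
apply: (@le_bounded_integrable _ 1) => [|x]; last exact: sin_max.
exact: measurableT_comp measurable_sin _.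
Qed.

Let C := Rintegral P setT (fun x => cos (theta x)).
Let S := Rintegral P setT (fun x => sin (theta x)).

Lemma integral_affine_trig (c a b : R) :
  (\int[P]_x (c + a * cos (theta x) + b * sin (theta x))%:E =
   (c * fine (P setT) + a * C + b * S)%:E)%E.
Proof.
have ic : P.-integrable setT (EFin \o cst c) by exact: finite_measure_integrable_cst.
have iC : P.-integrable setT (EFin \o (fun x => a * cos (theta x))).
  apply: (@integrableZl _ _ _ P setT measurableT a (EFin \o (cos \o theta))).
  exact: integrable_cos.
have iS : P.-integrable setT (EFin \o (fun x => b * sin (theta x))).
  apply: (@integrableZl _ _ _ P setT measurableT b (EFin \o (sin \o theta))).
  exact: integrable_sin.
have icC : P.-integrable setT (EFin \o (fun x => c + a * cos (theta x))).
  exact: (@integrableD _ _ _ P setT measurableT _ _ ic iC).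
have icCS : P.-integrable setT (EFin \o (fun x => c + a * cos (theta x) + b * sin (theta x))).
  exact: (@integrableD _ _ _ P setT measurableT _ _ icC iS).
rewrite -[LHS]fineK; last exact: integrable_fin_num icCS.
congr EFin; rewrite -/(Rintegral P setT (fun x => c + a * cos (theta x) + b * sin (theta x))).
rewrite RintegralD// RintegralD// Rintegral_cst// !RintegralZl//.
  exact: integrable_sin.
exact: integrable_cos.
Qed.

Lemma integral_shifted_cos alpha :
  (\int[P]_x (1 + cos (theta x - alpha))%:E =
   (fine (P setT) + cos alpha * C + sin alpha * S)%:E)%E.
Proof.
rewrite -[fine _]mul1r -integral_affine_trig; apply: eq_integral => x _.
by rewrite cosB addrA [cos (theta x) * _]mulrC [sin (theta x) * _]mulrC.
Qed.

(** The real part of e^(-i alpha) (C + i S) is at most the modulus; the difference of the squares is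
    (cos alpha S - sin alpha C)^2. *)
Lemma shifted_cos_le_modulus alpha :
  cos alpha * C + sin alpha * S <= Num.sqrt (C ^+ 2 + S ^+ 2).
Proof.
apply: le_trans (ler_norm _) _; rewrite -sqrtr_sqr ler_sqrt ?addr_ge0 ?sqr_ge0//.
rewrite -subr_ge0 -[C ^+ 2 + _]mul1r -(cos2Dsin2 alpha).
by rewrite (_ : _ - _ = (cos alpha * S - sin alpha * C) ^+ 2) ?sqr_ge0//; ring.
Qed.

End trigonometric_integrals.

Section finite_product.
Local Open Scope ereal_scope.
Context (R : realType) d1 d2 (T1 : measurableType d1) (T2 : measurableType d2).
Variables (P1 : {finite_measure set T1 -> \bar R}) (P2 : {finite_measure set T2 -> \bar R}).

(** Named so that it can carry a sigma-finite structure: Tonelli is later applied with this product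
    as one of its two factors. *)
Definition finite_prod := (P1 \x P2)%E.
HB.instance Definition _ := Measure.on finite_prod.

Lemma sigma_finite_finite_prod : sigma_finite setT finite_prod.
Proof.
exists (fun=> setT) => [|k]; first by rewrite bigcup_const//; exists 0%N.
split=> //; rewrite /finite_prod -setXTT product_measure1E//.
by rewrite ltey_eq fin_numM// fin_num_measure.
Qed.

HB.instance Definition _ :=
  Measure_isSigmaFinite.Build _ _ _ finite_prod sigma_finite_finite_prod.
End finite_product.

Lemma cos1_le_cos (R : realType) (t : R) : `|t| <= 1 -> cos 1 <= cos t.
Proof.
have pi1 : 1 <= pi :> R by apply: le_trans (pi_ge2 R); rewrite ler1n.
move=> t1; rewrite -(cos_norm t) leNgt ltr_cos -?leNgt// in_itv/= ?normr_ge0 ?ler01//.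
exact: le_trans pi1.
Qed.

(** Absence of cancellation: P lives on Q, where the phase stays in [-1, 1] and the cosine is at
    least cos 1. *)
Lemma cos1_le_Rintegral d (T : measurableType d) (R : realType)
    (P : {finite_measure set T -> \bar R}) (Q : set T) (theta : T -> R) :
  measurable Q -> P (~` Q) = 0%E -> measurable_fun setT theta ->
  (forall x, Q x -> `|theta x| <= 1) ->
  cos 1 * fine (P setT) <= Rintegral P setT (fun x => cos (theta x)).
Proof.
move=> mQ PQ mt t1; rewrite -Rintegral_cst//.
have mQc : measurable (~` Q) by exact: measurableC.
have icst : P.-integrable setT (EFin \o cst (cos 1)).
  exact: finite_measure_integrable_cst.
have icos := integrable_cos P mt.
rewrite /Rintegral (negligible_integral mQc measurableT icst PQ).
rewrite (negligible_integral mQc measurableT icos PQ).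
rewrite setDE setTI setCK; apply: le_Rintegral => //.
- exact: finite_measure_integrable_cst.
- exact: (integrableS measurableT).
- by move=> x /t1; exact: cos1_le_cos.
Qed.

(** * An integrable Fourier transform forces a bounded density *)

Section fourier_density.
Context (R : realType) (n : nat).
Local Notation T := (Rspace R n).
Local Notation m := (lebRn R n).

Lemma measurable_dotv d (S : measurableType d) (u v : S -> 'rV[R]_n.+1) :
  (forall i, measurable_fun setT (fun s => u s 0 i)) ->
  (forall i, measurable_fun setT (fun s => v s 0 i)) ->
  measurable_fun setT (fun s => dotv (u s) (v s)).
Proof.
by move=> mu mv; apply: measurable_sum => i; exact: measurable_funM.
Qed.

Lemma dotv_bound (u v : 'rV[R]_n.+1) (a b : R) :
  (forall i, `|u 0 i| <= a) -> (forall i, `|v 0 i| <= b) ->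
  `|dotv u v| <= n.+1%:R * (a * b).
Proof.
move=> ua vb; apply: le_trans (ler_norm_sum _ _ _) _.
rewrite mulr_natl -[X in _ *+ X](card_ord n.+1) -sumr_const.
by apply: ler_sum => i _; rewrite normrM ler_pM.
Qed.

Lemma dotvBl k (u v w : 'rV[R]_k) : dotv (u - v) w = dotv u w - dotv v w.
Proof. by rewrite /dotv -sumrB; apply: eq_bigr => i _; rewrite !mxE mulrBl. Qed.

Lemma dotvC k (u v : 'rV[R]_k) : dotv u v = dotv v u.
Proof. by apply: eq_bigr => i _; rewrite mulrC. Qed.

Variable nu : {finite_measure set T -> \bar R}.
Hypothesis nu_hat : m.-integrable setT (fun xi => (fourier_abs nu xi)%:E).

Let I := fine (\int[m]_xi (fourier_abs nu xi)%:E)%E.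

Let fourier_ge0 xi : 0 <= fourier_abs nu xi. Proof. exact: sqrtr_ge0. Qed.

Let I_E : (\int[m]_xi (fourier_abs nu xi)%:E = I%:E)%E.
Proof. by rewrite fineK//; exact: integrable_fin_num. Qed.

Let mfourier : measurable_fun setT (fourier_abs nu).
Proof. by apply/measurable_EFinP; case/integrableP: nu_hat. Qed.

(* With Q = box 0 rho and u = y - z,
     \int_Q \int_Q (1 + cos ((a - b).u)) = |Q|^2 + (\int_Q cos)^2 + (\int_Q sin)^2;
   adding 1 to the cosine makes every integrand nonnegative, so that Tonelli applies. *)
Lemma fourier_box_bound z r : 0 < r ->
  exists M : R, [/\ 0 < M, M = (2 / (n.+1%:R * r)) ^+ n.+1 &
    fine (nu (box z r)) * (cos 1 * M) ^+ 2 <= M * I].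
Proof.
move=> r0.
(* The dual size: for b in Q and y in [box z r], each of the n+1 terms of b.(y - z) is at most
   [rho * r], so the phase is at most 1. *)
pose rho : R := (n.+1%:R * r)^-1.
have rho0 : 0 < rho by rewrite invr_gt0 mulr_gt0.
pose Q : set T := box (unvec 0) rho.
have mQ : measurable Q by exact: measurable_box.
pose M := (rho *+ 2) ^+ n.+1.
have QM : m Q = M%:E by exact: lebRn_box (ltW rho0).
have M0 : 0 < M by rewrite exprn_gt0// mulrn_wgt0.
exists M; split=> //; first by rewrite /M -[rho *+ 2]mulr_natl.
have Qoo : (m Q < +oo)%E by rewrite QM ltry.
(* Lebesgue measure restricted to Q: integrals over Q become integrals of a finite measure over the
   whole space. *)
pose P : {finite_measure set T -> \bar R} := mfrestr mQ Qoo.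
have PE A : P A = m (A `&` Q) by [].
have PT : P setT = M%:E by rewrite PE setTI.
have PQ : P (~` Q) = 0%E by rewrite PE setICl measure0.
pose N := fine (nu setT).
have N0 : 0 <= N by apply: fine_ge0.
have PTfin : fine (P setT) = M by rewrite PT.
pose arg (aby : (T * T) * T) : R :=
  dotv (vec aby.2) (vec aby.1.1 - vec aby.1.2) - dotv (vec z) (vec aby.1.1 - vec aby.1.2).
pose F (aby : (T * T) * T) : \bar R := (1 + cos (arg aby))%:E.
have mdiff i : measurable_fun setT
    (fun aby : (T * T) * T => (vec aby.1.1 - vec aby.1.2 : 'rV[R]_n.+1) 0 i).
  apply: (eq_measurable_fun (fun aby : (T * T) * T => vec aby.1.1 0 i - vec aby.1.2 0 i)).
    by move=> aby _; rewrite !mxE.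
  apply: measurable_funB; apply: (measurableT_comp (measurable_coord i)).
    exact: (measurableT_comp measurable_fst measurable_fst).
  exact: (measurableT_comp measurable_snd measurable_fst).
have mF : measurable_fun setT F.
  apply/measurable_EFinP; apply: measurable_funD => //.
  apply: (measurableT_comp (@measurable_cos R)); apply: measurable_funB.
    apply: measurable_dotv => // i.
    exact: (measurableT_comp (measurable_coord i) measurable_snd).
  exact: measurable_dotv.
have F0 aby : (0 <= F aby)%E by rewrite lee_fin -lerBlDl sub0r cos_geN1.
pose PP : {sigma_finite_measure set (T * T)%type -> \bar R} := finite_prod P P.
(* The integral is bounded below with y outermost and above with (a, b) outermost. The term
   [M ^+ 2 * N] due to the added 1 occurs in both bounds and cancels at the end. *)
have := @fubini_tonelli _ _ _ _ R PP nu F mF F0.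
pose theta y (b : T) : R := dotv (vec b) (vec y - vec z).
have mtheta y : measurable_fun setT (theta y).
  by apply: measurable_dotv => // i; exact: measurable_coord.
have lower : ((M ^+ 2 * N + (cos 1 * M) ^+ 2 * fine (nu (box z r)))%:E <=
    \int[nu]_y \int[PP]_ab F (ab, y))%E.
  have mbox := measurable_box z r.
  have -> : ((M ^+ 2 * N + (cos 1 * M) ^+ 2 * fine (nu (box z r)))%:E =
      \int[nu]_y ((M ^+ 2)%:E + ((cos 1 * M) ^+ 2)%:E * (\1_(box z r) y)%:E))%E.
    rewrite ge0_integralD//; last 3 first.
    - by move=> y _; rewrite lee_fin sqr_ge0.
    - by move=> y _; rewrite mule_ge0// lee_fin ?sqr_ge0.
    - apply/measurable_EFinP; apply: measurable_funM => //; exact: measurable_indic.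
    rewrite integral_cst// ge0_integralZl//; last 2 first.
    - by apply/measurable_EFinP; exact: measurable_indic.
    - by rewrite lee_fin sqr_ge0.
    rewrite integral_indic// setIT EFinD !EFinM !fineK//; exact: fin_num_measure.
  apply: ge0_le_integral => //.
  - by move=> y _; rewrite adde_ge0// ?mule_ge0// lee_fin ?sqr_ge0.
  - apply: emeasurable_funD => //; apply: measurable_funeM.
    by apply/measurable_EFinP; exact: measurable_indic.
  - exact: (@measurable_fun_fubini_tonelli_G _ _ _ _ R PP F mF F0).
  move=> y _.
  have mFy : measurable_fun setT (fun ab => F (ab, y)) := measurableT_comp mF (measurable_pair2 y).
  rewrite (@fubini_tonelli1 _ _ _ _ R P P (fun ab => F (ab, y)) mFy (fun ab => F0 _)).
  set C := Rintegral P setT (fun b => cos (theta y b)).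
  set S := Rintegral P setT (fun b => sin (theta y b)).
  (* Integration over b leaves M + C cos(theta a) + S sin(theta a); integration over a then produces
     the squares. *)
  rewrite [leRHS](_ : _ = (M * M + C * C + S * S)%:E); last first.
    rewrite -{2}PTfin -(integral_affine_trig P (mtheta y)).
    apply: eq_integral => a _; rewrite [in RHS]mulrC [X in (_ + X)%R]mulrC.
    rewrite -PTfin -(integral_shifted_cos P (mtheta y)).
    apply: eq_integral => b _; rewrite /F /arg /= /theta; congr (1 + _)%:E.
    rewrite -cosN -dotvBl [in LHS]dotvC dotvBl; congr cos; ring.
  rewrite -EFinM -EFinD lee_fin -addrA lerD// indicE.
  case: (boolP (y \in _)); rewrite ?mulr0 ?mulr1 ?addr_ge0// -?expr2 ?sqr_ge0// inE => zy.
  apply: ler_wpDr; first exact: sqr_ge0.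
  have cM0 : 0 <= cos 1 * M by rewrite mulr_ge0// ltW// cos1_gt0.
  have CM : cos 1 * M <= C.
    rewrite -PTfin; apply: (cos1_le_Rintegral mQ PQ (mtheta y)) => b Qb.
    apply: le_trans (@dotv_bound _ _ rho r _ _) _.
    - by move=> i; have := Qb i; rewrite unvecK mxE subr0 => /ltW.
    - by move=> i; rewrite !mxE; exact/ltW/zy.
    - by rewrite /rho le_eqVlt; apply/orP; left; apply/eqP; field; rewrite gt_eqF//= pnatr_eq0.
  by rewrite lerXn2r// nnegrE// (le_trans cM0).
have upper : (\int[PP]_ab \int[nu]_y F (ab, y) <= ((N * M + I) * M)%:E)%E.
  pose phi (ab : T * T) := fourier_abs nu (vsub ab.1 ab.2).
  have mvsub : measurable_fun setT (fun ab : T * T => vsub ab.1 ab.2 : T).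
    apply: (@measurable_unvec R n _ _ (fun ab : T * T => vec ab.1 - vec ab.2)) => i.
    apply: (eq_measurable_fun (fun ab : T * T => vec ab.1 0 i - vec ab.2 0 i)).
      by move=> ab _; rewrite !mxE.
    by apply: measurable_funB; apply: (measurableT_comp (measurable_coord i)).
  have mphi : measurable_fun setT phi := measurableT_comp mfourier mvsub.
  have mNphi : measurable_fun setT (fun ab => (N + phi ab)%:E).
    by apply/measurable_EFinP; exact: measurable_funD.
  have Nphi0 ab : (0 <= (N + phi ab)%:E)%E by rewrite lee_fin addr_ge0// /phi fourier_ge0.
  apply: (@le_trans _ _ (\int[PP]_ab (N + phi ab)%:E)%E).
    apply: ge0_le_integral => //.
    - by move=> ab _; exact: integral_ge0.
    - exact: (@measurable_fun_fubini_tonelli_F _ _ _ _ R nu F mF F0).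
    move=> ab _.
    have mth : measurable_fun setT (fun y : T => dotv (vec y) (vec ab.1 - vec ab.2)).
      by apply: measurable_dotv => // i; exact: measurable_coord.
    rewrite [leLHS](integral_shifted_cos nu mth (dotv (vec z) (vec ab.1 - vec ab.2))).
    rewrite lee_fin -addrA lerD2l.
    apply: le_trans (shifted_cos_le_modulus _ _ _) _.
    by rewrite /phi /fourier_abs /vsub unvecK.
  rewrite (@fubini_tonelli1 _ _ _ _ R P P _ mNphi Nphi0).
  apply: (@le_trans _ _ (\int[P]_a (N * M + I)%:E)%E); last first.
    by rewrite EFinM -PT -integral_cst.
  apply: ge0_le_integral => //.
  - by move=> a _; exact: integral_ge0.
  - exact: (@measurable_fun_fubini_tonelli_F _ _ _ _ R P _ mNphi Nphi0).
  move=> a _.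
  have mphia : measurable_fun setT (fun b => (phi (a, b))%:E).
    apply/measurable_EFinP; exact: (measurableT_comp mphi (measurable_pair1 a)).
  have phia0 b : (0 <= (phi (a, b))%:E)%E by rewrite lee_fin /phi fourier_ge0.
  rewrite [leLHS](_ : _ = \int[P]_b (N%:E + (phi (a, b))%:E))%E; last exact: eq_integral.
  rewrite ge0_integralD// integral_cst// EFinD EFinM -[M%:E]PT leeD2l//.
  have mQc := measurableC mQ.
  rewrite (ge0_negligible_integral mQc measurableT mphia (fun b _ => phia0 b) PQ).
  rewrite setDE setTI setCK.
  have -> : (\int[P]_(b in Q) (phi (a, b))%:E = \int[m]_(b in Q) (phi (a, b))%:E)%E.
    apply: eq_measure_integral => A mA AQ.
    by transitivity (m (A `&` Q)); [exact: PE|rewrite setIidl].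
  (* For fixed a the domain Q is enlarged to the whole space, where b -> a - b preserves Lebesgue
     measure and yields I for every a. *)
  have := @ge0_subset_integral _ _ _ m Q setT mQ measurableT _ mphia
    (fun b _ => phia0 b) (@subsetT _ Q).
  move=> /le_trans; apply.
  rewrite -I_E.
  have mf : measurable_fun setT (fun xi => (fourier_abs nu xi)%:E) by exact/measurable_EFinP.
  have f0 xi : (0 <= (fourier_abs nu xi)%:E)%E by rewrite lee_fin fourier_ge0.
  have := @ge0_lebRn_integral_affine R n (-1) (vec a) _ _ mf f0.
  rewrite oppr_eq0 oner_eq0 normrN1 expr1n invr1 mul1e => /(_ isT) <-.
  rewrite le_eqVlt; apply/orP; left; apply/eqP; apply: eq_integral => b _.
  by rewrite /phi /vsub scaleN1r addrC.
move=> E; move: lower; rewrite -E => /le_trans/(_ upper); rewrite lee_fin.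
have -> : (N * M + I) * M = M ^+ 2 * N + M * I by ring.
by rewrite lerD2l mulrC.
Qed.

(** The volume M of the dual box satisfies M (2 r)^(n+1) = (4 / (n+1))^(n+1), so r drops out after
    division by M^2 cos(1)^2. *)
Lemma fourier_density : exists2 K : R, 0 <= K &
  forall z r, 0 < r -> (nu (box z r) <= K%:E * m (box z r))%E.
Proof.
have I0 : 0 <= I by apply: fine_ge0; apply: integral_ge0 => x _; rewrite lee_fin.
have c0 : 0 < (cos 1 : R) := cos1_gt0 R.
exists (I / cos 1 ^+ 2 * (n.+1%:R / 4) ^+ n.+1).
  apply: mulr_ge0; first by apply: divr_ge0 => //; exact: sqr_ge0.
  by apply: exprn_ge0; exact: divr_ge0.
move=> z r r0; have [M [M0 ME MI]] := fourier_box_bound z r0.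
rewrite lebRn_box ?(ltW r0)// -EFinM -[leLHS]fineK; last first.
  by apply: fin_num_measure; exact: measurable_box.
rewrite lee_fin.
rewrite -(ler_pM2r (exprn_gt0 2 (mulr_gt0 c0 M0))); apply: le_trans MI _.
rewrite le_eqVlt; apply/orP; left; apply/eqP.
have -> : I / cos 1 ^+ 2 * (n.+1%:R / 4) ^+ n.+1 * (r *+ 2) ^+ n.+1 * (cos 1 * M) ^+ 2
  = I * ((n.+1%:R / 4) ^+ n.+1 * (r *+ 2) ^+ n.+1 * M) * M.
  by field; rewrite gt_eqF.
rewrite {2}ME -!exprMn (_ : _ / 4 * _ * _ = 1) ?expr1n ?mulr1 1?mulrC//.
by field; rewrite gt_eqF//= pnatr_eq0.
Qed.

End fourier_density.

(** * Compactness, and linear growth of the modulus of continuity *)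

Section modulus_of_continuity.
Context (R : realType) (n : nat).
Local Notation T := (Rspace R n).
Variables (Omega : set T) (f : T -> R).

Lemma ecompact_nat_cover (U : nat -> set T) : ecompact Omega ->
  (forall k, eopen (U k)) -> Omega `<=` \bigcup_k U k ->
  exists N : nat, forall x, Omega x -> exists2 k, (k <= N)%N & U k x.
Proof.
move=> cO oU OU; have [s sP] := cO _ U oU OU.
(* The sum of the finite list of indices serves as an upper bound for each of them. *)
have inN i : List.In i s -> (i <= sumn s)%N.
  elim: s {sP} => //= a s IH [->|/IH]; first exact: leq_addr.
  by move=> /leq_trans; apply; exact: leq_addl.
by exists (sumn s) => x /sP[i /inN iN Uix]; exists i.
Qed.

Lemma ecompact_sub_box : ecompact Omega ->
  exists2 r, 0 < r & Omega `<=` box (unvec 0 : T) r.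
Proof.
move=> cO; have [| |N NP] := @ecompact_nat_cover (fun k => eball (unvec 0 : T) k%:R) cO.
- by move=> k; exact: eopen_eball.
- move=> x _; exists (Num.truncn (Defs.edist x (unvec 0))).+1 => //.
  exact: truncnS_gt.
exists N.+1%:R => // x /NP[k kN /eball_sub_box xk] i.
by apply: lt_trans (xk i) _; rewrite ltr_nat.
Qed.

Lemma econtinuous_on_ecompact_bounded : ecompact Omega -> econtinuous_on Omega f ->
  exists2 M, 0 <= M & forall x, Omega x -> `|f x| <= M.
Proof.
move=> cO cf.
pose B k := [set xr : T * R | forall y, Omega y -> eball xr.1 xr.2 y -> `|f y| <= k%:R].
have [| |N NP] := @ecompact_nat_cover (fun k => \bigcup_(xr in B k) eball xr.1 xr.2) cO.
- move=> k x [xr xrB xxr]; have [r r0 sub] := eopen_eball xxr.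
  by exists r => // y /sub yxr; exists xr.
- move=> x Ox; have [del del0 fx] := cf x Ox 1 ltr01.
  exists (Num.truncn (`|f x| + 1)).+1 => //; exists (x, del) => /=.
    move=> y Oy /(fx y Oy) fyx; apply/ltW/(lt_trans _ (truncnS_gt _)).
    rewrite -(subrK (f x) (f y)) addrC.
    by apply: le_lt_trans (ler_normD _ _) _; rewrite ltrD2l.
  by rewrite /eball/= /Defs.edist subrr enorm0.
exists N%:R => // x Ox; have [k kN [xr xrB xxr]] := NP x Ox.
by apply: le_trans (xrB x Ox xxr) _; rewrite ler_nat.
Qed.

(** The bound M on f makes the set in [modcont] bounded above; only then is [sup] an actual supremum
    and not a default value. *)
Lemma le_modcont M x y t : (forall x, Omega x -> `|f x| <= M) ->
  Omega x -> Omega y -> Defs.edist x y <= t -> `|f x - f y| <= modcont Omega f t.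
Proof.
move=> fM Ox Oy xyt; apply: ub_le_sup; last by exists x, y.
exists (M + M) => _ [a [b [Oa Ob _ ->]]].
by apply: le_trans (ler_normB _ _) _; rewrite lerD ?fM.
Qed.

Lemma edist_segmentl (x y : T) (t : R) : 0 <= t ->
  Defs.edist x (unvec ((1 - t) *: vec x + t *: vec y)) = t * Defs.edist x y.
Proof.
move=> t0; rewrite /Defs.edist unvecK.
rewrite (_ : _ - _ = t *: (vec x - vec y)) ?enormZ ?ger0_norm//.
by apply/rowP => i; rewrite !mxE; ring.
Qed.

Lemma edist_segmentr (x y : T) (t : R) : t <= 1 ->
  Defs.edist (unvec ((1 - t) *: vec x + t *: vec y)) y = (1 - t) * Defs.edist x y.
Proof.
move=> t1; rewrite /Defs.edist unvecK.
rewrite (_ : _ - _ = (1 - t) *: (vec x - vec y)) ?enormZ ?ger0_norm ?subr_ge0//.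
by apply/rowP => i; rewrite !mxE; ring.
Qed.

Lemma modcont_chain M h k x y : econvex Omega ->
  (forall x, Omega x -> `|f x| <= M) -> 0 < h ->
  Omega x -> Omega y -> Defs.edist x y <= k.+1%:R * h ->
  `|f x - f y| <= k.+1%:R * modcont Omega f h.
Proof.
move=> cvO fM h0; elim: k x => [|k IH] x Ox Oy xy.
  by rewrite mul1r (le_modcont fM)// -[h]mul1r.
have k0 : 0 < k.+2%:R :> R by [].
(* Moving by the fraction 1/(k+2) of the segment is one step of length at most h, and leaves a
   distance of at most (k+1) h. *)
pose t : R := k.+2%:R^-1.
have t0 : 0 <= t by rewrite invr_ge0.
have t1 : t <= 1 by rewrite invf_le1// ler1n.
have kt : k.+2%:R * t = 1 by rewrite mulfV// gt_eqF.
pose z := unvec ((1 - t) *: vec x + t *: vec y) : T.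
have Oz : Omega z by apply: cvO => //; rewrite t0.
have xz : Defs.edist x z <= h.
  rewrite edist_segmentl// (le_trans (ler_wpM2l t0 xy))//.
  by rewrite mulrA [t * _]mulrC kt mul1r.
have zy : Defs.edist z y <= k.+1%:R * h.
  have t1' : 0 <= 1 - t by rewrite subr_ge0.
  rewrite edist_segmentr// (le_trans (ler_wpM2l t1' xy))//.
  rewrite mulrA mulrBl mul1r [t * _]mulrC kt -[k.+2]addn1 natrD addrK//.
rewrite -(subrKA (f z)) (le_trans (ler_normD _ _))//.
rewrite -[k.+2]add1n natrD mulrDl mul1r lerD//; last exact: IH.
exact: (le_modcont fM).
Qed.

(** With q = |x - y| / h, floor(q) + 1 steps along the segment suffice, and this number is at most 1
    + q. *)
Lemma modcont_linear_growth M h x y : econvex Omega ->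
  (forall x, Omega x -> `|f x| <= M) -> 0 < h -> Omega x -> Omega y ->
  `|f x - f y| <= modcont Omega f h * (1 + Defs.edist x y / h).
Proof.
move=> cvO fM h0 Ox Oy.
have w0 : 0 <= modcont Omega f h.
  apply: le_trans (le_modcont (t := h) fM Ox Ox _); first exact: normr_ge0.
  by rewrite /Defs.edist subrr enorm0 ltW.
pose q := Defs.edist x y / h.
have q0 : 0 <= q by rewrite divr_ge0 ?enorm_ge0// ltW.
have xy : Defs.edist x y <= (Num.truncn q).+1%:R * h.
  by rewrite -ler_pdivrMr// ltW// truncnS_gt.
apply: le_trans (modcont_chain cvO fM h0 Ox Oy xy) _.
rewrite mulrC ler_wpM2l// -natr1 addrC lerD2l.
by have /truncn_itv/andP[] := q0.
Qed.

End modulus_of_continuity.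

(** * From a sup bound on Omega to all L^p norms *)

Section restricted_Lnorm.
Context d (T : measurableType d) (R : realType).
Variables (mu : {measure set T -> \bar R}) (Omega : set T) (mO : measurable Omega).
Local Open Scope ereal_scope.
Import HBNNSimple.

Let mrestrC : mrestr mu mO (~` Omega) = 0.
Proof. by rewrite /mrestr setICl measure0. Qed.

(* For non-measurable F the integral is the supremum over the simple functions below F. *)
Lemma integral_mrestr_le (F : T -> \bar R) (b : R) :
  (forall x, 0 <= F x) -> (forall x, Omega x -> F x <= b%:E) ->
  \int[mrestr mu mO]_x F x <= b%:E * mu Omega.
Proof.
move=> F0 Fb; rewrite ge0_integralTE//; apply: ge_ereal_sup => _ [h hF <-].
have mh : measurable_fun setT (EFin \o h) by exact/measurable_EFinP.
have h0 x : setT x -> 0 <= (h x)%:E by rewrite lee_fin.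
have mOc := measurableC mO.
rewrite -integralT_nnsfun (ge0_negligible_integral mOc measurableT mh h0 mrestrC).
rewrite setDE setTI setCK.
have -> : b%:E * mu Omega = \int[mrestr mu mO]_(x in Omega) (cst b%:E x).
  by rewrite integral_cst//= /mrestr setIid.
apply: ge0_le_integral => //.
- by move=> x _; exact: h0.
- exact: (measurable_funS measurableT (@subsetT _ _) mh).
- by move=> x Ox; apply: le_trans (hF x) (Fb x Ox).
Qed.

(** For finite p the norm is at most B V^(1/p), and 1 + V dominates both V^(1/p) for every p >= 1
    and the factor 1 of the case of infinite p; hence one constant for all p. *)
Lemma Lnorm_mrestr_le (F : T -> R) (B V : R) (p : \bar R) :
  (0 <= B)%R -> (0 <= V)%R -> mu Omega = V%:E ->
  (forall x, Omega x -> `|F x| <= B)%R -> 1 <= p ->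
  Lnorm (mrestr mu mO) p (EFin \o F) <= (B * (1 + V))%:E.
Proof.
move=> B0 V0 OV FB; rewrite unlock; case: p => [p| |]//= p1; last first.
  (* For infinite p the norm is an essential supremum, except that it is 0 by convention for the
     zero measure. *)
  case: ifPn => _; last by rewrite lee_fin mulr_ge0// addr_ge0.
  apply: (@le_trans _ _ B%:E).
    apply: ereal_inf_lbound; exists (~` Omega); split=> //; first exact: measurableC.
    by move=> x /= H Ox; apply: H; rewrite lee_fin FB.
  by rewrite lee_fin ler_peMr// lerDl.
rewrite lee_fin in p1; have p0 : (0 < p)%R by exact: lt_le_trans p1.
have pV0 : (0 <= p^-1)%R by rewrite invr_ge0 ltW.
apply: (@le_trans _ _ (((B `^ p)%R%:E * mu Omega) `^ p^-1)).
  apply: gt0_ler_poweR => //.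
  - by rewrite in_itv/= leey integral_ge0// => x _; rewrite lee_fin powR_ge0.
  - by rewrite in_itv/= leey mule_ge0// lee_fin powR_ge0.
  apply: integral_mrestr_le => [x|x Ox]; first by rewrite lee_fin powR_ge0.
  rewrite lee_fin ge0_ler_powR ?nnegrE//; [exact: ltW|exact: FB].
rewrite OV -EFinM poweR_EFin lee_fin powRM ?powR_ge0// -powRrM mulfV ?gt_eqF// powRr1//.
apply: ler_wpM2l => //.
have [V1|V1] := leP V 1%R; last first.
  apply: (@le_trans _ _ V); last by rewrite lerDr.
  by apply: ler1_powR; [exact: ltW|rewrite invf_le1].
apply: (@le_trans _ _ 1%R); last by rewrite lerDl.
have H1 : (1 `^ p^-1 = 1 :> R)%R by rewrite powR1.
by rewrite -[leRHS]H1 ge0_ler_powR ?nnegrE.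
Qed.

End restricted_Lnorm.

(** * Weighted averages, and the two integrals of the rescaled kernel *)

(** With D the total weight, D times the deviation is the integral of (a - f) w, which is dominated
    by W g. The same g also supplies the integrability of w and, as f is bounded, of f w. *)
Lemma weighted_average_dist d (T : measurableType d) (R : realType)
    (mu : {measure set T -> \bar R}) (Omega : set T) (f w g : T -> R)
    (a M W A c : R) :
  measurable Omega -> measurable_fun Omega f -> measurable_fun Omega w ->
  (forall x, Omega x -> `|f x| <= M) ->
  (forall x, Omega x -> 0 <= w x <= g x) ->
  mu.-integrable Omega (EFin \o g) -> Rintegral mu Omega g <= A ->
  0 < c -> c <= Rintegral mu Omega w ->
  (forall x, Omega x -> `|a - f x| * w x <= W * g x) -> 0 <= W ->
  `|a - Rintegral mu Omega (fun x => f x * w x) / Rintegral mu Omega w| <= W * A / c.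
Proof.
move=> mO mf mw fM wg ig gA c0 cw faW W0.
have iw : mu.-integrable Omega (EFin \o w).
  apply: le_integrable ig => //; first exact/measurable_EFinP.
  move=> x Ox /=; have /andP[w0 wgx] := wg x Ox.
  by rewrite lee_fin !ger0_norm// (le_trans w0).
have ifw : mu.-integrable Omega (EFin \o (fun x => f x * w x)).
  apply: (@le_integrable _ _ _ _ _ mO _ (EFin \o (fun x => M * w x))).
  - exact/measurable_EFinP/measurable_funM.
  - move=> x Ox /=; have /andP[w0 _] := wg x Ox.
    have M0 : 0 <= M := le_trans (normr_ge0 _) (fM x Ox).
    by rewrite lee_fin !normrM ler_wpM2r// (le_trans (fM x Ox))// ler_norm.
  - exact: (@integrableZl _ _ _ mu Omega mO M (EFin \o w)).
have iaw : mu.-integrable Omega (EFin \o (fun x => a * w x)).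
  exact: (@integrableZl _ _ _ mu Omega mO a (EFin \o w)).
have iWg : mu.-integrable Omega (EFin \o (fun x => W * g x)).
  exact: (@integrableZl _ _ _ mu Omega mO W (EFin \o g)).
have idiff : mu.-integrable Omega (EFin \o (fun x => a * w x - f x * w x)).
  exact: (@integrableB _ _ _ mu Omega mO _ _ iaw ifw).
set D := Rintegral mu Omega w; set N := Rintegral mu Omega _.
have D0 : 0 < D := lt_le_trans c0 cw.
have -> : a - N / D = (a * D - N) / D by field; rewrite gt_eqF.
rewrite normrM normfV (gtr0_norm D0).
suff H : `|a * D - N| <= W * A.
  apply: ler_pM => //; first by rewrite invr_ge0 ltW.
  by rewrite lef_pV2// posrE.
rewrite /D -RintegralZl// -RintegralB//.
apply: le_trans (le_normr_Rintegral mO idiff) _.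
apply: (@le_trans _ _ (Rintegral mu Omega (fun x => W * g x))); last first.
  by rewrite RintegralZl// ler_wpM2l.
apply: le_Rintegral => //; first exact: integrable_norm.
move=> x Ox; have /andP[w0 _] := wg x Ox.
by rewrite -mulrBl normrM (ger0_norm w0) faW.
Qed.

Section rescaled_kernel.
Context (R : realType) (n : nat).
Local Notation T := (Rspace R n).
Local Notation m := (lebRn R n).

Lemma econtinuous_cst (c : R) : econtinuous (fun _ : T => c).
Proof. by move=> x e e0; exists 1 => // y _; rewrite subrr normr0. Qed.

Lemma econtinuousM (a b : T -> R) :
  econtinuous a -> econtinuous b -> econtinuous (fun x => a x * b x).
Proof.
move=> ca cb x e e0; pose s := 2 + `|a x| + `|b x|.
have s0 : 0 < s by rewrite ltr_wpDr// ltr_wpDr.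
pose e' := Num.min 1 (e / s).
have e'0 : 0 < e' by rewrite lt_min ltr01 divr_gt0.
have e'1 : e' <= 1 by rewrite ge_min lexx.
have e's : e' * s <= e by rewrite -ler_pdivlMr// ge_min lexx orbT.
have [da da0 Ha] := ca x _ e'0; have [db db0 Hb] := cb x _ e'0.
exists (Num.min da db) => [|y]; first by rewrite lt_min da0.
rewrite lt_min => /andP[/Ha ya /Hb yb].
have -> : a y * b y - a x * b x =
  (a y - a x) * (b y - b x) + (a y - a x) * b x + a x * (b y - b x) by ring.
apply: le_lt_trans (ler_normD _ _) _.
apply: le_lt_trans (lerD (ler_normD _ _) (lexx _)) _.
rewrite !normrM; apply: lt_le_trans e's.
apply: (@le_lt_trans _ _ (e' * 1 + e' * `|b x| + `|a x| * e')).
  apply: lerD; first apply: lerD.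
  - by apply: ler_pM => //; [exact: ltW|exact: le_trans (ltW yb) e'1].
  - by apply: ler_wpM2r => //; exact: ltW.
  - by apply: ler_wpM2l => //; exact: ltW.
rewrite [`|a x| * _]mulrC -!mulrDr ltr_pM2l// /s; lra.
Qed.

Lemma econtinuous_affine (a : R) (b : 'rV[R]_n.+1) (G : T -> R) : a != 0 ->
  econtinuous G -> econtinuous (fun y => G (unvec (a *: vec y + b))).
Proof.
move=> a0 cG x e e0; have [del del0 H] := cG (unvec (a *: vec x + b)) e e0.
exists (del / `|a|) => [|y yx]; first by rewrite divr_gt0// normr_gt0.
apply: H; rewrite /Defs.edist !unvecK opprD addrACA subrr addr0 -scalerBr enormZ.
by rewrite mulrC -ltr_pdivlMr// normr_gt0.
Qed.

Lemma econtinuous_enorm : econtinuous (fun u : T => 1 + enorm (vec u)).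
Proof.
move=> x e e0; exists e => // y yx.
rewrite (_ : _ - _ = enorm (vec y) - enorm (vec x)); last by ring.
by apply: le_lt_trans yx; exact: ler_dist_enorm.
Qed.

Lemma scaled_vsub h (x y : T) :
  h^-1 *: vec (vsub x y) = - h^-1 *: vec y + h^-1 *: vec x.
Proof. by rewrite /vsub unvecK scalerBr scaleNr addrC. Qed.

Lemma econtinuous_psih psi h (x : T) : 0 < h ->
  econtinuous psi -> econtinuous (fun y => psih psi h (vsub x y)).
Proof.
move=> h0 cpsi; rewrite /psih; under eq_fun do rewrite scaled_vsub.
apply: econtinuousM; first exact: econtinuous_cst.
by apply: econtinuous_affine => //; rewrite oppr_eq0 invr_eq0 gt_eqF.
Qed.

(** The growth factor of [modcont_linear_growth] times the kernel: the dominating function g of the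
    weighted average. *)
Definition moment_kernel (psi : T -> R) h (x y : T) : R :=
  (1 + Defs.edist x y / h) * psih psi h (vsub x y).

Lemma moment_kernelE psi h (x y : T) : 0 < h ->
  moment_kernel psi h x y = h ^- n.+1 *
    ((fun u : T => (1 + enorm (vec u)) * psi u) (unvec (- h^-1 *: vec y + h^-1 *: vec x))).
Proof.
move=> h0; rewrite /moment_kernel /psih -scaled_vsub unvecK enormZ /vsub unvecK.
by rewrite gtr0_norm ?invr_gt0// /Defs.edist [_ / h]mulrC; ring.
Qed.

Lemma econtinuous_moment_kernel psi h (x : T) : 0 < h ->
  econtinuous psi -> econtinuous (moment_kernel psi h x).
Proof.
move=> h0 cpsi; rewrite [moment_kernel psi h x](funext (fun y => moment_kernelE psi x y h0)).
apply: econtinuousM; first exact: econtinuous_cst.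
apply: (@econtinuous_affine _ _ (fun u : T => (1 + enorm (vec u)) * psi u)).
  by rewrite oppr_eq0 invr_eq0 gt_eqF.
by apply: econtinuousM => //; exact: econtinuous_enorm.
Qed.

(** The substitution u = (x - y) / h absorbs the factor h^-(n+1), so the value depends neither on h
    nor on x. *)
Lemma integral_moment_kernel psi h (x : T) : 0 < h ->
  econtinuous psi -> (forall u, 0 <= psi u) ->
  (\int[m]_y (moment_kernel psi h x y)%:E =
   \int[m]_u (psi u)%:E + \int[m]_u (enorm (vec u) * psi u)%:E)%E.
Proof.
move=> h0 cpsi psi0; pose G (u : T) := (1 + enorm (vec u)) * psi u.
have cG : econtinuous G by apply: econtinuousM => //; exact: econtinuous_enorm.
have mG : measurable_fun setT (EFin \o G).
  by apply/measurable_EFinP; exact: measurable_econtinuous.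
have G0 u : (0 <= (G u)%:E)%E by rewrite lee_fin mulr_ge0// addr_ge0// enorm_ge0.
have hN0 : - h^-1 != 0 by rewrite oppr_eq0 invr_eq0 gt_eqF.
pose phi (y : T) : T := unvec (- h^-1 *: vec y + h^-1 *: vec x).
transitivity (\int[m]_y ((h ^- n.+1)%:E * (G (phi y))%:E))%E.
  by apply: eq_integral => y _; rewrite moment_kernelE.
have mGphi : measurable_fun setT (fun y => (G (phi y))%:E).
  exact: (measurableT_comp mG (measurable_affine _ _)).
have hn0 : (0 <= (h ^- n.+1)%:E)%E by rewrite lee_fin invr_ge0 exprn_ge0// ltW.
rewrite (@ge0_integralZl _ _ _ m setT measurableT _ mGphi _ (fun y _ => G0 (phi y)) hn0).
rewrite (ge0_lebRn_integral_affine (h^-1 *: vec x) hN0 mG G0).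
rewrite normrN gtr0_norm ?invr_gt0// muleA -EFinM exprVn invrK mulVf ?mul1e; last first.
  by rewrite expf_neq0// gt_eqF.
have mpsi : measurable_fun setT psi by exact: measurable_econtinuous.
have menorm : measurable_fun setT (fun u : T => enorm (vec u)).
  apply: (eq_measurable_fun (fun u : T => (1 + enorm (vec u)) - 1)).
    by move=> u _; ring.
  apply: measurable_funB => //; apply: measurable_econtinuous; exact: econtinuous_enorm.
rewrite -ge0_integralD//.
- by apply: eq_integral => u _; rewrite /= /G mulrDl mul1r.
- by move=> u _; rewrite lee_fin psi0.
- exact/measurable_EFinP.
- by move=> u _; rewrite lee_fin mulr_ge0// enorm_ge0.
- exact/measurable_EFinP/measurable_funM.
Qed.

Lemma psih_ge0 psi h (x : T) : 0 < h -> (forall u, 0 <= psi u) -> 0 <= psih psi h x.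
Proof. by move=> h0 psi0; rewrite mulr_ge0// invr_ge0 exprn_ge0// ltW. Qed.

Lemma psih_le_moment_kernel psi h (x y : T) : 0 < h -> (forall u, 0 <= psi u) ->
  psih psi h (vsub x y) <= moment_kernel psi h x y.
Proof.
by move=> h0 psi0; rewrite ler_peMl ?psih_ge0// lerDl divr_ge0 ?enorm_ge0// ltW.
Qed.

(** On [eball x h] the kernel is at least Cpsi h^-(n+1). The ball contains a box of half-side h /
    (n+2), of volume (2 h / (n+2))^(n+1), and the powers of h cancel. *)
Lemma integral_psih_ge (mu : {measure set T -> \bar R}) (Omega : set T) psi h
    (x : T) (C1 Cpsi : R) : 0 < h -> measurable Omega ->
  econtinuous psi -> (forall u, 0 <= psi u) -> 0 < C1 -> 0 < Cpsi ->
  (forall u, enorm (vec u) <= 1 -> Cpsi <= psi u) ->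
  (C1%:E * m (eball x h) <= mu (Omega `&` eball x h))%E ->
  ((C1 * Cpsi * (2 / n.+2%:R) ^+ n.+1)%:E <=
   \int[mu]_(y in Omega) (psih psi h (vsub x y))%:E)%E.
Proof.
move=> h0 mO cpsi psi0 C10 Cpsi0 psiC muC.
have mB := measurable_eball x h.
have c0 : 0 <= Cpsi * h ^- n.+1 by rewrite mulr_ge0 ?invr_ge0 ?exprn_ge0 ?ltW.
apply: (@le_trans _ _ (\int[mu]_(y in Omega) ((Cpsi * h ^- n.+1)%:E * (\1_(eball x h) y)%:E))%E).
  rewrite ge0_integralZl//; last by apply/measurable_EFinP; exact: measurable_indic.
  rewrite integral_indic// setIC.
  have muB : (C1%:E * m (box x (h / n.+2%:R)) <= mu (Omega `&` eball x h))%E.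
    apply: le_trans muC; apply: lee_wpmul2l; first by rewrite lee_fin ltW.
    apply: le_measure; rewrite ?inE//; first exact: measurable_box.
    exact: box_sub_eball.
  apply: le_trans (lee_wpmul2l _ muB); rewrite ?lee_fin//.
  rewrite lebRn_box; last by rewrite divr_ge0// ltW.
  rewrite -!EFinM lee_fin -[(h / _) *+ 2]mulr_natl le_eqVlt; apply/orP; left; apply/eqP.
  rewrite (_ : 2 * (h / n.+2%:R) = (2 / n.+2%:R) * h); last by ring.
  have H0 : h ^+ n.+1 != 0 by rewrite expf_neq0// gt_eqF.
  rewrite [(_ * h) ^+ _]exprMn; move: ((2 / n.+2%:R) ^+ n.+1) (h ^+ n.+1) H0 => q H H0.
  by field.
apply: ge0_le_integral => //.
- by move=> y _; rewrite mule_ge0 ?lee_fin.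
- apply: measurable_funTS; apply: measurable_funeM.
  by apply/measurable_EFinP; exact: measurable_indic.
- apply: measurable_funTS; apply/measurable_EFinP; apply: measurable_econtinuous.
  exact: econtinuous_psih.
move=> y _; rewrite -EFinM lee_fin indicE.
case: (boolP (y \in _)); rewrite ?mulr0 ?mulr1 ?psih_ge0// inE => xy.
rewrite /psih [leLHS]mulrC; apply: ler_wpM2l.
  by rewrite invr_ge0 exprn_ge0// ltW.
apply: psiC; rewrite unvecK enormZ gtr0_norm ?invr_gt0// mulrC ler_pdivrMr// mul1r.
by rewrite /vsub unvecK -enormN opprB ltW.
Qed.

End rescaled_kernel.

(* Euclidean dimension d = n.+1 >= 1 *)
Theorem theorem3p2 (R : realType) (n : nat)
  (Omega : set (Rspace R n)) (mO : measurable Omega)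
  (Omega_compact : ecompact Omega) (Omega_convex : econvex Omega)
  (Omega_domain : has_interior Omega)
  (Omega_lip : lipschitz_boundary Omega)
  (mu : probability (Rspace R n) R) (mu_on_Omega : mu (~` Omega) = 0%E)
  (C1 : R) (C1_gt0 : 0 < C1)
  (mu_lower : forall (x : Rspace R n) (a : R), Omega x -> 0 < a <= 1 ->
     (C1%:E * lebRn R n (eball x a) <= mu (Omega `&` eball x a))%E)
  (mustar : {finite_measure set Rspace R n -> \bar R})
  (mustar_ext : forall A, measurable A -> A `<=` Omega -> mustar A = mu A)
  (mustar_hat_L1 : (lebRn R n).-integrable setT
                     (fun xi => (fourier_abs mustar xi)%:E))
  (psi : Rspace R n -> R) (psi_cont : econtinuous psi)
  (psi_ge0 : forall x, 0 <= psi x)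
  (psi_int1 : (\int[lebRn R n]_x (psi x)%:E = 1)%E)
  (psi_moment : (\int[lebRn R n]_x (enorm (vec x) * psi x)%:E < +oo)%E)
  (Cpsi : R) (Cpsi_gt0 : 0 < Cpsi)
  (psi_lower : forall x, enorm (vec x) <= 1 -> Cpsi <= psi x)
  (f : Rspace R n -> R) (f_cont : econtinuous_on Omega f) :
  exists2 C : R, 0 < C &
    forall h : R, 0 < h < 1 -> forall p : \bar R, (1 <= p)%E ->
      (Lnorm (mrestr (lebRn R n) mO) p (fun x => (f x - fmin mu Omega psi f h x)%:E)
         <= (C * modcont Omega f h)%:E)%E.
Proof.
have [K K0 nuK] := fourier_density mustar_hat_L1.
have [M M0 fM] := econtinuous_on_ecompact_bounded Omega_compact f_cont.
have [r r0 Or] := ecompact_sub_box Omega_compact.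
(* This point of [Omega] is used to obtain [0 <= modcont Omega f h]. *)
have [x0 [r' r'0 x0r']] := Omega_domain.
have Ox0 : Omega x0 by apply: x0r'; rewrite /eball/= /Defs.edist subrr enorm0.
pose V := fine (lebRn R n Omega).
have VE : lebRn R n Omega = V%:E.
  rewrite fineK// ge0_fin_numE//.
  apply: (@le_lt_trans _ _ (lebRn R n (box (unvec 0) r))).
    by apply: le_measure; rewrite ?inE//; exact: measurable_box.
  by rewrite lebRn_box ?ltry// ltW.
have V0 : 0 <= V by exact: fine_ge0.
pose mom := fine (\int[lebRn R n]_x (enorm (vec x) * psi x)%:E)%E.
have mom_ge0 : (0 <= \int[lebRn R n]_x (enorm (vec x) * psi x)%:E)%E.
  by apply: integral_ge0 => x _; rewrite lee_fin mulr_ge0// enorm_ge0.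
have momE : (\int[lebRn R n]_x (enorm (vec x) * psi x)%:E = mom%:E)%E.
  by rewrite fineK// ge0_fin_numE.
have mom0 : 0 <= mom by exact: fine_ge0.
pose A := K * (1 + mom).
have A0 : 0 <= A by rewrite mulr_ge0// addr_ge0.
pose c := C1 * Cpsi * (2 / n.+2%:R) ^+ n.+1.
have c0 : 0 < c by rewrite !mulr_gt0// exprn_gt0// divr_gt0.
(* [A / c] bounds the quotient of the two integrals and [1 + V] converts sup norms to L^p norms; the
   added 1 keeps the constant positive even when [A] is 0. *)
exists ((A / c + 1) * (1 + V)).
  apply: mulr_gt0; last exact: ltr_wpDr.
  by apply: ltr_wpDl => //; apply: divr_ge0 => //; exact: ltW.
move=> h /andP[h0 h1] p p1; set w := modcont Omega f h.
have w0 : 0 <= w.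
  apply: le_trans (@le_modcont _ _ Omega f M x0 x0 h fM Ox0 Ox0 _) => //.
  by rewrite /Defs.edist subrr enorm0 ltW.
rewrite mulrAC; apply: Lnorm_mrestr_le => //.
  by rewrite mulr_ge0// addr_ge0// divr_ge0// ltW.
move=> x Ox.
apply: (@le_trans _ _ (w * A / c)); last first.
  by rewrite (_ : _ * w = w * A / c + w) ?lerDl//; ring.
pose g := moment_kernel psi h x.
have g_ge0 y : 0 <= g y.
  exact: le_trans (psih_ge0 _ h0 psi_ge0) (psih_le_moment_kernel x y h0 psi_ge0).
have cg : econtinuous g := econtinuous_moment_kernel x h0 psi_cont.
have mg D : measurable_fun D (EFin \o g).
  by apply: measurable_funTS; apply/measurable_EFinP; exact: measurable_econtinuous.
have intg : (\int[mu]_(y in Omega) (g y)%:E <= A%:E)%E.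
  (* Inside [Omega] mu is exchanged for its extension, whose integral may then be enlarged to the
     whole space, where the box bound applies. *)
  rewrite (eq_measure_integral mustar); last by move=> B mB BO; apply/esym/mustar_ext.
  have Eg0 y : setT y -> (0 <= (EFin \o g) y)%E by rewrite /= lee_fin.
  have := @ge0_subset_integral _ _ _ mustar Omega setT mO measurableT _ (mg _) Eg0 (@subsetT _ _).
  move=> /le_trans; apply.
  apply: le_trans (ge0_le_integral_box_density K0 nuK cg g_ge0) _.
  by rewrite integral_moment_kernel// psi_int1 momE -EFinD -EFinM.
have g_integral_ge0 : (0 <= \int[mu]_(y in Omega) (g y)%:E)%E.
  by apply: integral_ge0 => y _; rewrite lee_fin.
have ig : mu.-integrable Omega (EFin \o g).
  apply/integrableP; split; first exact: mg.
  under eq_integral do rewrite /= ger0_norm//.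
  exact: le_lt_trans intg (ltry _).
have iw : mu.-integrable Omega (fun y => (psih psi h (vsub x y))%:E).
  apply: le_integrable ig => //.
    apply: measurable_funTS; apply/measurable_EFinP; apply: measurable_econtinuous.
    exact: econtinuous_psih.
  move=> y _ /=; rewrite lee_fin !ger0_norm ?psih_ge0//.
  exact: psih_le_moment_kernel.
apply: (@weighted_average_dist _ _ R mu Omega f (fun y => psih psi h (vsub x y)) g
  (f x) M w A c) => //.
- exact: measurable_econtinuous_on.
- by apply: measurable_funTS; apply: measurable_econtinuous; exact: econtinuous_psih.
- by move=> y Oy; rewrite psih_ge0// psih_le_moment_kernel.
- by rewrite /Rintegral -lee_fin fineK// ge0_fin_numE// (le_lt_trans intg)// ltry.
- rewrite /Rintegral -lee_fin fineK; last exact: integrable_fin_num.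
  (* Here [h < 1] enters: the ball condition covers radii up to 1. *)
  by apply: integral_psih_ge => //; apply: mu_lower => //; rewrite h0 ltW.
- move=> y Oy; rewrite /g /moment_kernel mulrA ler_wpM2r ?psih_ge0//.
  exact: (modcont_linear_growth Omega_convex fM).
Qed.
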